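(* Let $R$ be a nonzero associative unital ring, $n$ a positive integer, $G$ a group, and $\rho$ a preorder on $\overline{n}=\{1,\ldots,n\}$. Suppose that $M_n(\rho,R)$ is equipped with a very good $G$-grading that is strong. Then $|G|\leq n$. Moreover, if $|G|=n$, then $\rho=\overline{n}\times\overline{n}$, and hence $M_n(\rho,R)=M_n(R)$.
   Context: For $X,Y\subseteq\overline{n}\times\overline{n}$ put $XY=\{(i,k)\mid \exists j\in\overline{n}:\ (i,j)\in X,\ (j,k)\in Y\}$. A preorder is a reflexive and transitive relation. A $G$-grading on a preorder $\rho$ is a family $(\rho_g)_{g\in G}$ of pairwise disjoint (possibly empty) subsets of $\rho$ with $\rho=\bigcup_{g\in G}\rho_g$ and $\rho_g\rho_h\subseteq\rho_{gh}$ for all $g,h\in G$. $e_{i,j}$ is the $n\times n$ matrix over $R$ with $1$ in position $(i,j)$ and zeros elsewhere; $M_n(\rho,R)=\sum_{(i,j)\in\rho}Re_{i,j}\subseteq M_n(R)$ is the structural matrix ring. A $G$-grading on $S=M_n(\rho,R)$ is very good if there is a $G$-grading $(\rho_g)_{g\in G}$ on $\rho$ with $S_g=\sum_{(i,j)\in\rho_g}Re_{i,j}$ for all $g\in G$. A $G$-grading $(S_g)_{g\in G}$ on a unital ring $S$ is strong if $S_gS_{g^{-1}}=S_e$ for every $g\in G$, where $e$ is the identity of $G$ and a product of additive subgroups is the additive subgroup generated by products. *)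

(* Defs.v *)
From HB Require Import structures.
From mathcomp Require Import all_boot all_order all_algebra.

Set Implicit Arguments.
Unset Strict Implicit.
Unset Printing Implicit Defensive.

Import GRing.Theory.
Local Open Scope ring_scope.

(* The set {1, ..., n} is represented by 'I_n = {0, ..., n-1}, and relations  *)
(* on it by sets of pairs.                                                    *)

Definition relset_comp n (X Y : {set 'I_n * 'I_n}) : {set 'I_n * 'I_n} :=
  [set p | [exists j, ((p.1, j) \in X) && ((j, p.2) \in Y)]].

Definition is_preorder n (rho : {set 'I_n * 'I_n}) : Prop :=
  reflexive [rel i j | (i, j) \in rho] /\
  transitive [rel i j | (i, j) \in rho].

Definition is_preorder_grading (G : groupType) n (rho : {set 'I_n * 'I_n})
    (rho_ : G -> {set 'I_n * 'I_n}) : Prop :=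
  [/\ forall g h, g <> h -> [disjoint rho_ g & rho_ h],
      forall p, p \in rho <-> exists g, p \in rho_ g
    & forall g h, relset_comp (rho_ g) (rho_ h) \subset rho_ (g * h)%g].

(* Required only here because it rebinds the notations of finset used above.  *)
From mathcomp Require Import boolp classical_sets functions cardinality fsbigop.

Local Open Scope classical_set_scope.

Definition structural_mx (R : nzRingType) n (X : {set 'I_n * 'I_n}) :
    set 'M[R]_n :=
  [set A | exists c : 'I_n * 'I_n -> R,
             A = \sum_(p in X) c p *: delta_mx p.1 p.2].
Arguments structural_mx R {n} X.

Definition is_additive_subgroup (V : zmodType) (X : set V) : Prop :=
  X 0 /\ forall x y, X x -> X y -> X (x - y).

Definition additive_prod (A : pzRingType) (X Y : set A) : set A :=
  smallest (@is_additive_subgroup A)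
           [set z | exists x y, [/\ X x, Y y & z = x * y]].

(* x is the sum of the finitely supported family f of components f g \in S_g *)
Definition is_decomposition (G : choiceType) (V : zmodType) (S_ : G -> set V)
    (x : V) (f : G -> V) : Prop :=
  [/\ forall g, S_ g (f g), finite_set [set g | f g != 0]
    & x = \sum_(g \in [set: G]) f g].

(* Meant for a subring S of A: S is the internal direct sum of the additive   *)
(* subgroups S_ g (second and third clauses).                                 *)
Definition is_ring_grading (G : groupType) (A : pzRingType) (S : set A)
    (S_ : G -> set A) : Prop :=
  [/\ forall g, is_additive_subgroup (S_ g),
      forall x f, is_decomposition S_ x f -> S x,
      forall x, S x -> exists! f, is_decomposition S_ x f
    & forall g h, additive_prod (S_ g) (S_ h) `<=` S_ (g * h)%g].

Definition is_very_good (R : nzRingType) (G : groupType) n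
    (rho : {set 'I_n * 'I_n}) (S_ : G -> set 'M[R]_n) : Prop :=
  exists rho_ : G -> {set 'I_n * 'I_n},
    is_preorder_grading rho rho_ /\ forall g, S_ g = structural_mx R (rho_ g).

Definition is_strong (G : groupType) (A : pzRingType) (S_ : G -> set A) : Prop :=
  forall g, additive_prod (S_ g) (S_ g^-1%g) = S_ 1%g.

(* Main.v *)
Require Import Defs.
From HB Require Import structures.
From mathcomp Require Import all_boot all_order all_algebra.
From mathcomp Require Import boolp classical_sets functions cardinality fsbigop.
Local Open Scope ring_scope.
Local Open Scope classical_set_scope.
Local Open Scope card_scope.

(* Every diagonal position lies in the component rho_e. If row i met no
   position of rho_g, all matrices in S_g S_{g^-1} would vanish at (i, i),
   contradicting strongness since e_{i,i} lies in S_e. Hence every row meets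
   every component, and disjointness of the components turns a choice of one
   position per component in row i into an injection from G to {1, ..., n}; if
   |G| = n it is onto, so row i is full. *)

Set Implicit Arguments.
Unset Strict Implicit.
Unset Printing Implicit Defensive.

Import GRing.Theory.

(** Trades the existential over coefficients for vanishing of entries outside [X]; the entries
    themselves serve as coefficients. *)
Lemma structural_mxP (R : nzRingType) n (X : {set 'I_n * 'I_n}) (A : 'M[R]_n) :
  structural_mx R X A <-> forall i j, (i, j) \notin X -> A i j = 0.
Proof.
split=> [[c ->] i j ijX|A0].
  rewrite summxE big1// => -[k l] klX; rewrite !mxE /=.
  case: eqP => [ik|_]; last by rewrite mulr0.
  case: eqP => [jl|_]; last by rewrite mulr0.
  by rewrite ik jl klX in ijX.
exists (fun p => A p.1 p.2).
rewrite [LHS]matrix_sum_delta pair_bigA /=.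
rewrite [RHS]big_mkcond; apply: eq_bigr => -[i j] _ /=.
by case: ifPn => // /A0 ->; rewrite scale0r.
Qed.

(** The pair [(i, i)] composed with itself is [(i, i)], so its degree [g] satisfies [g * g = g] by
    disjointness, and the only idempotent of a group is its identity. *)
Lemma diag_grading_identity (G : groupType) n (rho : {set 'I_n * 'I_n})
    (rho_ : G -> {set 'I_n * 'I_n}) (i : 'I_n) :
  is_preorder rho -> is_preorder_grading rho rho_ -> (i, i) \in rho_ 1%g.
Proof.
move=> [rho_refl _] [rho_disj rhoE rho_comp].
have [g ig] := (rhoE (i, i)).1 (rho_refl i).
have igg : (i, i) \in rho_ (g * g)%g.
  apply: (fintype.subsetP (rho_comp g g)).
  by rewrite inE; apply/existsP; exists i; rewrite ig.
have [gg|/rho_disj] := EM ((g * g)%g = g).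
  suff <- : g = 1%g by [].
  by apply: (mulgI g); rewrite gg mulg1.
by move=> /fintype.disjointFr /(_ igg); rewrite ig.
Qed.

Lemma strong_row_nonempty (R : nzRingType) (G : groupType) n
    (rho_ : G -> {set 'I_n * 'I_n}) (i : 'I_n) :
  is_strong (fun g => structural_mx R (rho_ g)) -> (i, i) \in rho_ 1%g ->
  forall g, exists j, (i, j) \in rho_ g.
Proof.
move=> strong ii1 g; apply: contrapT => /forallNP row_empty.
have : structural_mx R (rho_ 1%g) (delta_mx i i).
  apply/structural_mxP => k l kl; rewrite mxE.
  by case: eqP => // ki; case: eqP => // li; rewrite ki li ii1 in kl.
(* The generated subgroup is tested against the additive subgroup of matrices vanishing at [(i, i)].
   It contains every generator [x * y], since row [i] of [x] is zero. *)
rewrite -(strong g) => /(_ [set A : 'M[R]_n | A i i = 0]) /= ii0.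
suff : delta_mx i i i i = 0 :> R by rewrite mxE !eqxx => /eqP; rewrite oner_eq0.
apply: ii0; split; first split.
- by rewrite /= mxE.
- by move=> x y /= x0 y0; rewrite !mxE x0 y0 subr0.
- move=> _ [x [y [/structural_mxP x0 _ ->]]] /=.
  by rewrite mxE big1// => j _; rewrite x0 ?mul0r//; apply/negP/row_empty.
Qed.

(** Composing [f] with a section of the bijection from [T] to the first [n] naturals gives an
    injective self-map of the finite type ['I_n], which is therefore onto. *)
Lemma card_eq_inj_ord_surj (T : Type) n (f : T -> 'I_n) :
  injective f -> [set: T] #= `I_n -> forall j, exists x, f x = j.
Proof.
move=> f_inj /card_set_bijP[g [_ _ g_surj]] j.
have /choice[h hK] (k : 'I_n) : exists x, g x = k.
  by have [x _ gx] := g_surj k (ltn_ord k); exists x.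
have fh_inj : injective (f \o h).
  by move=> k l /f_inj hkl; apply: val_inj; rewrite /= -!hK hkl.
by have [q _ qK] := injF_bij fh_inj; exists (h (q j)); exact: qK.
Qed.

Theorem theorem25 (R : nzRingType) (n : nat) (n_gt0 : (0 < n)%N)
    (G : groupType) (rho : {set 'I_n * 'I_n}) (rho_preorder : is_preorder rho)
    (S_ : G -> set 'M[R]_n)
    (S_grading : is_ring_grading (structural_mx R rho) S_)
    (S_very_good : is_very_good rho S_)
    (S_strong : is_strong S_) :
  ([set: G] #<= `I_n) /\
  ([set: G] #= `I_n ->
     rho = [set: 'I_n * 'I_n]%SET /\
     structural_mx R rho = [set: 'M[R]_n]).
Proof.
have [rho_ [rho_grading S_E]] := S_very_good.
have [rho_disj rhoE _] := rho_grading.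
rewrite (_ : S_ = fun g => structural_mx R (rho_ g)) in S_strong; last exact/funext.
have row i : {f : G -> 'I_n & forall g, (i, f g) \in rho_ g}.
  have ii1 := diag_grading_identity i rho_preorder rho_grading.
  exact: choice (strong_row_nonempty S_strong ii1).
have row_inj i (f : G -> 'I_n) : (forall g, (i, f g) \in rho_ g) -> injective f.
  move=> fP g h fgh; apply: contrapT => /rho_disj /fintype.disjointFr /(_ (fP g)).
  by rewrite fgh fP.
split=> [|cardG].
  (* Any single row gives the bound; positivity of [n] ensures that row 0 exists. *)
  have [f /row_inj f_inj] := row (Ordinal n_gt0).
  have fI_inj : {in [set: G] &, injective (fun g => f g : nat)}.
    by move=> g h _ _ /val_inj /f_inj.
  rewrite -(card_le_eql (inj_card_eq fI_inj)); apply: subset_card_le.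
  by move=> _ [g _ <-]; exact: ltn_ord.
have rhoT : rho = [set: 'I_n * 'I_n]%SET.
  apply/setP => -[i j]; rewrite inE; apply/rhoE.
  have [f fP] := row i.
  have [g <-] := card_eq_inj_ord_surj (row_inj _ _ fP) cardG j.
  by exists g.
split=> //; rewrite rhoT; apply/seteqP; split=> // A _.
by apply/structural_mxP => i j; rewrite inE.
Qed.
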